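(* Let $\alpha>2$ and $\lambda\in(0,1)$. Let $(\delta_1,\delta_2)$ be a pair of random variables, each with the Fréchet distribution of shape parameter $\alpha$, coupled by a Gumbel copula of parameter $1/\lambda$. Then the correlation between $\delta_1$ and $\delta_2$ is $$\rho(\delta_1,\delta_2)=\frac{\Gamma(1-2/\alpha)\,\Gamma(1-\lambda/\alpha)^2/\Gamma(1-2\lambda/\alpha)-\Gamma(1-1/\alpha)^2}{\Gamma(1-2/\alpha)-\Gamma(1-1/\alpha)^2}.$$
   Context: The Fréchet distribution of shape parameter $\alpha>0$ has cumulative distribution function $F(x)=\exp(-x^{-\alpha})$ for $x>0$ (and $F(x)=0$ for $x\le 0$). The Gumbel copula of parameter $1/\lambda$ is $$C(u,v)=\exp\left(-\left((-\log u)^{1/\lambda}+(-\log v)^{1/\lambda}\right)^{\lambda}\right).$$ That $\delta_1,\delta_2$ are coupled by $C$ means that the joint cumulative distribution function of $(\delta_1,\delta_2)$ is $(x,y)\mapsto C(F(x),F(y))$. $\Gamma$ is the Gamma function $\Gamma(z)=\int_0^{\infty}t^{z-1}e^{-t}\,dt$. ''Correlation'' is the Pearson correlation coefficient. *)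

(* Defs.v *)
From HB Require Import structures.
From mathcomp Require Import all_boot all_order all_algebra.
From mathcomp Require Import all_classical all_reals all_analysis.

Set Implicit Arguments.
Unset Strict Implicit.
Unset Printing Implicit Defensive.

Import Order.TTheory GRing.Theory Num.Theory.
Import numFieldNormedType.Exports.

Local Open Scope classical_set_scope.
Local Open Scope ring_scope.

(* Meaningful for 0 < z only: the integral diverges for z <= 0, where [Gamma]
   takes an irrelevant value. *)
Definition Gamma (R : realType) (z : R) : R :=
  \int[@lebesgue_measure R]_(t in `]0, +oo[) (t `^ (z - 1) * expR (- t)).

Definition frechet_cdf (R : realType) (alpha x : R) : R :=
  if 0 < x then expR (- (x `^ (- alpha))) else 0.

Definition has_frechet_distribution d (T : measurableType d) (R : realType)
    (P : probability T R) (alpha : R) (X : {RV P >-> R}) : Prop :=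
  forall x : R, cdf X x = (frechet_cdf alpha x)%:E.

(* The first branch is the boundary convention - log 0 = +oo, exp (-oo) = 0,
   which has to be made explicit because [ln 0 = 0]. *)
Definition gumbel_copula (R : realType) (theta u v : R) : R :=
  if (u <= 0) || (v <= 0) then 0
  else expR (- (((- ln u) `^ theta + (- ln v) `^ theta) `^ theta^-1)).

Definition joint_cdf d (T : measurableType d) (R : realType)
    (P : probability T R) (X Y : {RV P >-> R}) (x y : R) : \bar R :=
  P (X @^-1` `]-oo, x] `&` Y @^-1` `]-oo, y]).

(* [F] and [G] are the cumulative distribution functions of [X] and [Y]. *)
Definition coupled_by d (T : measurableType d) (R : realType)
    (P : probability T R) (C : R -> R -> R) (F G : R -> R)
    (X Y : {RV P >-> R}) : Prop :=
  forall x y : R, joint_cdf X Y x y = (C (F x) (G y))%:E.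

(* Pearson's coefficient, extended-real valued like [covariance] and
   ['V_P[X]]; an infinite variance yields 0 as [(+oo)^-1 = 0]. *)
Definition correlation d (T : measurableType d) (R : realType)
    (P : probability T R) (X Y : T -> R) : \bar R :=
  (covariance P X Y / (sqrte 'V_P[X] * sqrte 'V_P[Y]))%E.

(* Main.v *)
Require Import Defs.
From HB Require Import structures.
From mathcomp Require Import all_boot all_order all_algebra.
From mathcomp Require Import all_classical all_reals all_analysis.
From mathcomp Require Import measurable_realfun ring lra.

Set Implicit Arguments.
Unset Strict Implicit.
Unset Printing Implicit Defensive.

Import Order.TTheory GRing.Theory Num.Theory.
Import numFieldNormedType.Exports.

Local Open Scope classical_set_scope.
Local Open Scope ring_scope.

(** Put q = lambda / alpha and, on the event delta1, delta2 > 0 of probability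
one, delta1 = A ^ (- q) and delta2 = B ^ (- q).  The Gumbel copula with Fréchet
margins says precisely that P (A > a, B > b) = G (a + b), where
G s = exp (- s ^ lambda).  So (A, B) has the density G'' (a + b) on the positive
quadrant: given A + B, the pair is uniform on a segment, whatever G is.
Consequently ([dirichlet]),
<<
  E (A ^ (- p) B ^ (- r)) = B(p, r) * \int_0^oo G'' (w) w ^ (1 - p - r) dw
>>
with a factor B(p, r) independent of G and a second factor depending on p + r
only.  Comparing the exponents (q, q) and (2q, 0), for this G and for
G s = exp (- s), eliminates all the unknown factors ([simplex_moment_ratio]):
<<
  E (delta1 delta2) * Gamma (1 - 2q) = E (delta1 ^ 2) * Gamma (1 - q) ^ 2 .
>>
Indeed for G s = exp (- s) the coordinates are independent exponential
variables, whose moments are values of Gamma.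

The hypotheses concern distribution functions only, whereas the density of
(A, B) lives on another space.  The bridge is the layer-cake formula
([layer_cake]), which writes an expectation as an integral of tail
probabilities.  Applied to delta1 delta2 on the probability space and to
s ^ (- q) t ^ (- q) with the weight G'' (s + t) on the quadrant, it yields twice
the same double integral of P (delta1 > x, delta2 > y)
([expectation_product_tail] and [simplex_moment_joint_tail]).  The moments of
delta1 and the values Gamma (1 - k / alpha) are compared in the same way,
through the mean of a Fréchet variable ([frechet_powR_moment],
[Gamma_frechet_mean]).

The denominator of the correlation is positive because a Fréchet variable is
not almost surely constant ([frechet_variance_gt0]). *)

(** * Tonelli's theorem on a product of domains and the layer-cake formula *)

Section tonelli.
Local Open Scope ereal_scope.

Lemma tonelli_in d1 d2 (T1 : measurableType d1) (T2 : measurableType d2)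
    (R : realType) (m1 : {sigma_finite_measure set T1 -> \bar R})
    (m2 : {sigma_finite_measure set T2 -> \bar R}) (D1 : set T1) (D2 : set T2)
    (f : (T1 * T2)%type -> \bar R) :
  measurable D1 -> measurable D2 -> measurable_fun [set: T1 * T2] f ->
  (forall x y, D1 x -> D2 y -> 0 <= f (x, y)) ->
  \int[m1]_(x in D1) \int[m2]_(y in D2) f (x, y) =
  \int[m2]_(y in D2) \int[m1]_(x in D1) f (x, y).
Proof.
move=> mD1 mD2 mf f0.
pose F := f \_ (D1 `*` D2).
have mF : measurable_fun setT F.
  by apply/(measurable_restrictT f); [exact: measurableX|exact: measurable_funTS].
have F0 z : 0 <= F z.
  by apply: erestrict_ge0 => -[x y] [/= D1x D2y]; exact: f0.
have FE x y : F (x, y) = if (x \in D1) && (y \in D2) then f (x, y) else 0.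
  by rewrite /F patchE in_setX.
transitivity (\int[m1]_x \int[m2]_y F (x, y)).
  rewrite integral_mkcond; apply: eq_integral => x _; rewrite patchE.
  case: ifPn => xD; last first.
    by rewrite integral0_eq// => y _; rewrite FE (negbTE xD).
  rewrite integral_mkcond; apply: eq_integral => y _.
  by rewrite FE xD patchE.
rewrite fubini_tonelli//.
rewrite [RHS]integral_mkcond; apply: eq_integral => y _; rewrite patchE.
case: ifPn => yD; last first.
  by rewrite integral0_eq// => x _; rewrite FE (negbTE yD) andbF.
rewrite [RHS]integral_mkcond; apply: eq_integral => x _.
by rewrite FE yD patchE andbT.
Qed.

(** Write [f t] as the measure of the points [x] with [0 < x < f t] and exchange
the integrals.  The weight [w] lets the formula be applied to one factor of a
product after the other, and lets a density play the role of a measure. *)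
Lemma layer_cake d (T : measurableType d) (R : realType)
    (m : {sigma_finite_measure set T -> \bar R}) (D : set T)
    (w : T -> \bar R) (f : T -> R) :
  measurable D -> measurable_fun setT w -> measurable_fun setT f ->
  (forall t, 0 <= w t) -> (forall t, (0 <= f t)%R) ->
  \int[m]_(t in D) (w t * (f t)%:E) =
  \int[lebesgue_measure]_(x in `]0%R, +oo[)
    \int[m]_(t in D `&` [set t | (x < f t)%R]) w t.
Proof.
move=> mD mw mf w0 f0.
pose GR := measurableTypeR R.
pose S := [set z : T * GR | (z.2 < f z.1)%R].
have mS : measurable S.
  rewrite (_ : S = (fun z : T * GR => (z.2 < f z.1)%R) @^-1` [set true])//.
  rewrite -[X in measurable X]setTI.
  by apply: measurable_fun_ltr => //; exact: measurableT_comp.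
pose F (z : T * GR) := w z.1 * (\1_S z)%:E.
have SE t x : \1_S (t, x) = (x < f t)%R%:R :> R.
  rewrite indicE /S; case: ltP => h; first by rewrite mem_set.
  by rewrite memNset//= => h'; rewrite ltNge h in h'.
transitivity (\int[m]_(t in D) \int[lebesgue_measure]_(x in `]0%R, +oo[) F (t, x)).
  apply: eq_integral => t _.
  rewrite /F/= ge0_integralZl//; last first.
    apply/measurable_EFinP; apply: measurable_funTS.
    rewrite (_ : (fun x : GR => _) = (\1_S : T * GR -> R) \o pair t)//.
    by apply: measurableT_comp => //; exact: measurable_indic.
  congr (_ * _).
  under eq_integral => x _.
    rewrite SE (_ : (x < f t)%R%:R = \1_(`]-oo, f t[%classic : set R) x); last first.
      rewrite indicE; case: ltP => h; [rewrite mem_set//= in_itv//|].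
      by rewrite memNset//= in_itv/= ltNge h.
    over.
  rewrite integral_indic//= setIC.
  rewrite (_ : _ `&` _ = `]0%R, f t[%classic); last first.
    by apply/seteqP; split=> x /=; rewrite !in_itv/= andbT => /andP.
  rewrite lebesgue_measure_itv/= lte_fin; case: ltP => // ft0.
    by rewrite sube0.
  by congr (_%:E); apply/eqP; rewrite eq_le f0 ft0.
rewrite (tonelli_in _ _ _ (f := F))//; last 2 first.
- apply: emeasurable_funM; first exact: measurableT_comp.
  by apply/measurable_EFinP; exact: measurable_indic.
- by move=> t x _ _; rewrite mule_ge0// lee_fin.
apply: eq_integral => x _.
rewrite [RHS]integral_mkcondr; apply: eq_integral => t _.
rewrite /F SE patchE; case: ifPn => [|].
  by rewrite inE/= => ->; rewrite mule1.
by rewrite notin_setE/= => /negP/negbTE ->; rewrite mule0.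
Qed.

End tonelli.

(** * Translations and dilations of the Lebesgue integral *)

Section affine_substitution.
Local Open Scope ereal_scope.
Context {R : realType}.
Local Notation mu := (@lebesgue_measure R).

Lemma integral_translate (a : R) (D : set R) (f : R -> \bar R) :
  measurable D -> measurable_fun setT f -> (forall x, 0 <= f x) ->
  \int[mu]_(x in +%R a @^-1` D) f (a + x)%R = \int[mu]_(x in D) f x.
Proof.
move=> mD mf f0.
have ma : measurable_fun setT (+%R a : R -> measurableTypeR R).
  exact: measurable_funD.
transitivity (\int[pushforward mu (+%R a : R -> measurableTypeR R)]_(x in D) f x).
  by rewrite ge0_integral_pushforward//; exact: measurable_funTS.
apply: eq_measure_integral => A mA _; apply/esym.
apply: lebesgue_measure_unique => // X [[b c]] _ <-.
rewrite /= /pushforward.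
rewrite (_ : _ @^-1` _ = `](b - a)%R, (c - a)%R]%classic); last first.
  by apply/seteqP; split=> x /=; rewrite !in_itv/= ltrBlDl lerBrDl.
by rewrite !lebesgue_measure_itv/= !lte_fin ltrD2r -!EFinB opprB addrA subrK.
Qed.

Lemma integral_dilate (c : R) (D : set R) (f : R -> \bar R) : (0 < c)%R ->
  measurable D -> measurable_fun setT f -> (forall x, 0 <= f x) ->
  c%:E * \int[mu]_(x in *%R c @^-1` D) f (c * x)%R = \int[mu]_(x in D) f x.
Proof.
move=> c0 mD mf f0.
have mc : measurable_fun setT ( *%R c : R -> measurableTypeR R).
  exact: measurable_funM.
transitivity (c%:E * \int[pushforward mu ( *%R c : R -> measurableTypeR R)]_(x in D) f x).
  by rewrite ge0_integral_pushforward//; exact: measurable_funTS.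
rewrite -[c]/((NngNum (ltW c0))%:num)%R -ge0_integral_mscale//; last first.
  exact: measurable_funTS.
apply: eq_measure_integral => A mA _; apply/esym.
apply: lebesgue_measure_unique => // X [[a b]] _ <-.
rewrite /= /mscale/= /pushforward.
rewrite (_ : _ @^-1` _ = `](c^-1 * a)%R, (c^-1 * b)%R]%classic); last first.
  by apply/seteqP; split=> x /=; rewrite !in_itv/= ltr_pdivrMl// ler_pdivlMl.
rewrite !lebesgue_measure_itv/= !lte_fin ltr_pM2l ?invr_gt0//.
case: ifPn => _; last by rewrite mule0.
by rewrite -!EFinD -!EFinM; congr EFin; rewrite mulrBr !mulVKf// gt_eqF.
Qed.

End affine_substitution.

(** * Antiderivatives of functions singular at the origin *)

Section antiderivative.
Local Open Scope ereal_scope.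
Context {R : realType}.
Local Notation mu := (@lebesgue_measure R).

(** Neither [w] nor [W] is controlled at the origin beyond the limit of [W], so
the fundamental theorem is applied between [a / (n + 2)] and [a], and [n] sent to
infinity by monotone convergence. *)
Lemma integral_antiderivative (w W : R -> R) (l a : R) : (0 < a)%R ->
  (forall x : R, (0 < x)%R -> (0 <= w x)%R) ->
  (forall x : R, (0 < x)%R -> {for x, continuous w}) ->
  (forall x : R, (0 < x)%R -> is_derive x 1%R W (w x)) ->
  W x @[x --> 0%R^'+] --> l ->
  \int[mu]_(x in `]0%R, a[) (w x)%:E = (W a - l)%:E.
Proof.
move=> a0 w0 cw dW Wl.
have e0 n : (0 < a / n.+2%:R)%R by rewrite divr_gt0.
have mw : measurable_fun (`]0%R, +oo[%classic : set R) w.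
  apply: open_continuous_measurable_fun => // x.
  by rewrite inE/= in_itv/= andbT; exact: cw.
pose F n : set R := `[(a / n.+2%:R)%R, a]%classic.
have FE : \bigcup_n F n = `]0%R, a]%classic.
  apply/seteqP; split=> x /=.
    by move=> [n _]; rewrite /F/= !in_itv/= => /andP[/(lt_le_trans (e0 n)) -> ->].
  rewrite in_itv/= => /andP[x0 xa].
  have ax0 : (0 <= a / x)%R by rewrite divr_ge0// ltW.
  (* a / x < n + 1 for n the integral part of a / x. *)
  exists (Num.truncn (a / x)) => //; rewrite /F/= in_itv/= xa andbT.
  rewrite ler_pdivrMr// mulrC -ler_pdivrMr//.
  by apply/ltW/(lt_trans (truncnS_gt _)); rewrite ltr_nat.
have FW n : \int[mu]_(x in F n) (w x)%:E = (W a - W (a / n.+2%:R)%R)%:E.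
  rewrite /F (continuous_FTC2 (F := W))//.
  - by rewrite ltr_pdivrMr// ltr_pMr// ltr1n.
  - apply: continuous_in_subspaceT => x; rewrite inE/= in_itv/= => /andP[ax _].
    by apply: cw; exact: lt_le_trans ax.
  - split.
    + move=> x; rewrite in_itv/= => /andP[ax _].
      by have [] := dW _ (lt_trans (e0 n) ax).
    + apply/cvg_at_right_filter/differentiable_continuous/derivable1_diffP.
      by have [] := dW _ (e0 n).
    + apply/cvg_at_left_filter/differentiable_continuous/derivable1_diffP.
      by have [] := dW _ a0.
  - move=> x; rewrite in_itv/= => /andP[ax _].
    by rewrite derive1E; have [] := dW _ (lt_trans (e0 n) ax).
have Fpos n x : F n x -> (0 < x)%R.
  by rewrite /F/= in_itv/= => /andP[/(lt_le_trans (e0 n))].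
rewrite integral_itv_bndo_bndc; last first.
  apply/measurable_EFinP; apply: measurable_funS mw => //.
  exact: subset_itvl.
rewrite -FE; have h : \int[mu]_(x in F n) (w x)%:E @[n --> \oo] -->
    \int[mu]_(x in \bigcup_n F n) (w x)%:E.
  apply: ge0_nondecreasing_set_cvg_integral => [m n mn|n|n|n x /Fpos /w0 ?].
  - rewrite subsetEset; apply: subset_itvr; rewrite bnd_simp.
    by rewrite ler_pM2l// lef_pV2 ?posrE// ler_nat !ltnS.
  - exact: measurable_itv.
  - apply/measurable_EFinP; apply: measurable_funS mw => // x /Fpos.
    by rewrite /= in_itv/= andbT.
  - by rewrite lee_fin.
move: h; under eq_cvg do rewrite FW; move=> h.
suff h2 : (W a - W (a / n.+2%:R)%R)%:E @[n --> \oo] --> (W a - l)%:E.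
  exact: cvg_unique h h2.
apply: cvg_EFin; first by near=> n.
apply: cvgB; first exact: cvg_cst.
move/cvg_at_rightP : Wl; apply; split => //.
rewrite -[0%R](mulr0 a); apply: cvgM; first exact: cvg_cst.
by have := @cvg_harmonic R; rewrite -cvg_shiftS.
Unshelve. all: by end_near. Qed.

End antiderivative.

(** * Real powers and stretched exponentials *)

Section powers.
Context {R : realType}.
Implicit Types x s p c : R.

Lemma ltr_powRN x s p : 0 < x -> 0 < s -> 0 < p ->
  (x < s `^ (- p)) = (s < x `^ (- p^-1)).
Proof.
move=> x0 s0 p0.
rewrite -[LHS]ltr_ln ?posrE ?powR_gt0// -[RHS]ltr_ln ?posrE ?powR_gt0//.
by rewrite !ln_powR !mulNr ltrNr -mulrN ltr_pdivlMl.
Qed.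

Lemma cvg_powRy c : 0 < c -> x `^ c @[x --> +oo] --> +oo.
Proof.
move=> c0; apply/cvgryPge => A; near=> x.
have x0 : 0 < x by near: x; exact: nbhs_pinfty_gt.
have [A0|A0] := leP A 0; first exact: le_trans A0 (powR_ge0 _ _).
rewrite -ler_ln ?posrE ?powR_gt0// ln_powR -ler_pdivrMl//.
rewrite -ler_expR lnK ?posrE//; near: x; apply: nbhs_pinfty_ge.
Unshelve. all: by end_near. Qed.

Lemma cvg_powRNy c : 0 < c -> x `^ (- c) @[x --> +oo] --> 0.
Proof.
move=> c0; under eq_fun do rewrite powRN.
apply/gtr0_cvgV0; last exact: cvg_powRy.
near=> x; apply: powR_gt0; near: x; exact: nbhs_pinfty_gt.
Unshelve. all: by end_near. Qed.

Lemma continuous_powR p x : 0 < x -> {for x, continuous (@powR R ^~ p)}.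
Proof.
move=> x0; apply/differentiable_continuous/derivable1_diffP.
by have [] := is_derive1_powR p x0.
Qed.

End powers.

Section stretched_exponential.
Context {R : realType}.
Implicit Types l s t : R.

(** The survival function of the Weibull law.  The case [l = 1] is the
exponential law. *)
Definition stretched l s := expR (- (s `^ l)).

Definition stretched_pdf l s := l * s `^ (l - 1) * stretched l s.

(** The opposite of the derivative of [stretched_pdf], that is, the second
derivative of [stretched]. *)
Definition stretched_pdfN1 l s :=
  l * ((1 - l) * s `^ (l - 2) + l * s `^ (2 * l - 2)) * stretched l s.

Lemma is_derive_stretched l s : 0 < s ->
  is_derive s 1 (stretched l) (- stretched_pdf l s).
Proof.
move=> s0.
have h : is_derive s 1 (expR \o (- (@powR R ^~ l)))
    (expR (- (s `^ l)) * - (l * s `^ (l - 1))).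
  apply: is_derive1_comp.
  by apply: is_deriveN; exact: is_derive1_powR.
by apply: is_derive_eq h _; rewrite /stretched_pdf /stretched mulrN mulrC.
Qed.

Lemma is_derive_stretched_pdf l s : 0 < s ->
  is_derive s 1 (stretched_pdf l) (- stretched_pdfN1 l s).
Proof.
move=> s0.
have h : is_derive s 1 ((l \*: (@powR R ^~ (l - 1))) * stretched l)
  ((l * s `^ (l - 1)) *: (- stretched_pdf l s) +
   stretched l s *: (l *: ((l - 1) * s `^ (l - 1 - 1)))).
  apply: is_deriveM; last exact: is_derive_stretched.
  by apply: is_deriveZ; exact: is_derive1_powR.
apply: is_derive_eq h _; rewrite /stretched_pdfN1 /stretched_pdf.
rewrite (_ : 2 * l - 2 = (l - 1) + (l - 1)); last by ring.
rewrite (@powRD _ s (l - 1) (l - 1)); last by apply/implyP => _; rewrite gt_eqF.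
rewrite (_ : l - 1 - 1 = l - 2); last by ring.
by rewrite /GRing.scale/=; ring.
Qed.

Lemma continuous_stretched_pdf l s : 0 < s -> {for s, continuous (stretched_pdf l)}.
Proof.
move=> s0; apply/differentiable_continuous/derivable1_diffP.
by have [] := is_derive_stretched_pdf l s0.
Qed.

Lemma continuous_stretched l s : 0 < s -> {for s, continuous (stretched l)}.
Proof.
move=> s0; apply/differentiable_continuous/derivable1_diffP.
by have [] := is_derive_stretched l s0.
Qed.

Lemma continuous_stretched_pdfN1 l s : 0 < s -> {for s, continuous (stretched_pdfN1 l)}.
Proof.
move=> s0; apply: cvgM; last exact: continuous_stretched.
apply: cvgM; first exact: cvg_cst.
by apply: cvgD; apply: cvgM;
  [exact: cvg_cst|exact: continuous_powR|exact: cvg_cst|exact: continuous_powR].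
Qed.

Lemma measurable_stretched l : measurable_fun setT (stretched l).
Proof.
by apply: measurableT_comp => //; apply: measurableT_comp => //; exact: measurable_powR.
Qed.

Lemma measurable_stretched_pdf l : measurable_fun setT (stretched_pdf l).
Proof.
apply: measurable_funM; last exact: measurable_stretched.
by apply: measurable_funM => //; exact: measurable_powR.
Qed.

Lemma measurable_stretched_pdfN1 l : measurable_fun setT (stretched_pdfN1 l).
Proof.
apply: measurable_funM; last exact: measurable_stretched.
apply: measurable_funM => //; apply: measurable_funD.
  by apply: measurable_funM => //; exact: measurable_powR.
by apply: measurable_funM => //; exact: measurable_powR.
Qed.

Lemma stretched_pdf_ge0 l s : 0 <= l -> 0 <= stretched_pdf l s.
Proof. by move=> l0; rewrite !mulr_ge0 ?powR_ge0 ?expR_ge0. Qed.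

Lemma stretched_pdfN1_ge0 l s : 0 <= l <= 1 -> 0 <= stretched_pdfN1 l s.
Proof.
move=> /andP[l0 l1]; rewrite !mulr_ge0 ?expR_ge0//.
by rewrite addr_ge0// mulr_ge0 ?powR_ge0// subr_ge0.
Qed.

Lemma cvg_stretched l : 0 < l -> stretched l s @[s --> 0^'+] --> (1 : R).
Proof.
move=> l0; rewrite (_ : 1 = expR (- 0)); last by rewrite oppr0 expR0.
exact: (cvg_comp _ _ (cvgN (powR_cvg0 l0)) (@continuous_expR R _)).
Qed.

(** For [l <= 1] the factor [l * s ^ (l - 1)] is at most [1] as soon as [1 <= s],
so the density is dominated there by the survival function. *)
Lemma cvg_stretched_pdf l : 0 < l <= 1 -> stretched_pdf l s @[s --> +oo] --> (0 : R).
Proof.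
move=> /andP[l0 l1].
apply: (@squeeze_cvgr _ _ _ _ (cst 0) (stretched l)).
- near=> s; have s1 : 1 <= s by near: s; apply: nbhs_pinfty_ge; rewrite num_real.
  rewrite /= stretched_pdf_ge0 /= ?(ltW l0)// /stretched_pdf ger_pMl ?expR_gt0//.
  rewrite mulr_ile1 ?powR_ge0 ?(ltW l0)//.
  by rewrite -[leRHS](powRr0 s) ler_powR// subr_le0.
- exact: cvg_cst.
- exact: (cvg_comp _ _ (cvg_powRy l0) (@cvgr_expR R)).
Unshelve. all: by end_near. Qed.

End stretched_exponential.

(** * Moments of negative order and the Gamma function *)

Section power_integrals.
Local Open Scope ereal_scope.
Context {R : realType}.
Local Notation mu := (@lebesgue_measure R).

(** Layer-cake formula for [s ^ (- p)]: its level set above [x] is the interval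
below [x ^ (- 1 / p)], on which [w] integrates to an increment of [W]. *)
Lemma power_moment (w W : R -> R) (l p : R) : (0 < p)%R ->
  measurable_fun setT w ->
  (forall s : R, (0 < s)%R -> (0 <= w s)%R) ->
  (forall s : R, (0 < s)%R -> {for s, continuous w}) ->
  (forall s : R, (0 < s)%R -> is_derive s 1%R W (w s)) ->
  W s @[s --> 0%R^'+] --> l ->
  \int[mu]_(s in `]0%R, +oo[) (w s * s `^ (- p))%:E =
  \int[mu]_(x in `]0%R, +oo[) (W (x `^ (- p^-1)) - l)%:E.
Proof.
move=> p0 mw w0 cw dW Wl.
pose D : set R := `]0%R, +oo[%classic.
have D0 s : D s -> (0 < s)%R by rewrite /D/= in_itv/= andbT.
(* The layer-cake formula wants a weight that is nonnegative everywhere. *)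
pose w' := (EFin \o w) \_ D.
transitivity (\int[mu]_(s in D) (w' s * (s `^ (- p))%:E)).
  by apply: eq_integral => s sD; rewrite /w' patchE sD.
have mD : measurable D by exact: measurable_itv.
rewrite layer_cake//; last 3 first.
- apply/(measurable_restrictT (EFin \o w)) => //.
  by apply/measurable_EFinP; exact: measurable_funTS.
- by move=> s; apply: erestrict_ge0 => {}s /D0 /w0; rewrite lee_fin.
- by move=> s; exact: powR_ge0.
apply: eq_integral => x; rewrite inE/= => /D0 x0.
rewrite (_ : D `&` _ = `]0%R, (x `^ (- p^-1))%R[%classic); last first.
  apply/seteqP; split => s /=.
    by move=> [/D0 s0]; rewrite ltr_powRN// in_itv/= s0.
  rewrite in_itv/= => /andP[s0]; rewrite -ltr_powRN//; split => //.
  by rewrite /D/= in_itv/= s0.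
rewrite -(integral_antiderivative (w := w))//; last exact: powR_gt0.
apply: eq_integral => s; rewrite inE/= in_itv/= => /andP[s0 _].
by rewrite /w' patchE mem_set// /D/= in_itv/= s0.
Qed.

(** The expectation of a Fréchet variable of shape [c], in the form of the
integral of its tail.  Every one-dimensional moment below is brought to this
form. *)
Definition frechet_mean (c : R) : \bar R :=
  \int[mu]_(x in `]0%R, +oo[) (1 - expR (- (x `^ (- c))))%:E.

(** If [S] has survival function [stretched l] then [S ^ (- p)] is a Fréchet
variable of shape [l / p]. *)
Lemma stretched_moment (l p : R) : (0 < l)%R -> (0 < p)%R ->
  \int[mu]_(s in `]0%R, +oo[) (stretched_pdf l s * s `^ (- p))%:E =
  frechet_mean (l / p).
Proof.
move=> l0 p0.
have dG (s : R) : (0 < s)%R -> is_derive s 1%R (- stretched l)%R (stretched_pdf l s).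
  move=> s0; rewrite -[stretched_pdf l s]opprK; apply: is_deriveN.
  exact: is_derive_stretched.
rewrite (power_moment p0 (measurable_stretched_pdf l) _ _ dG (cvgN (cvg_stretched l0))).
- apply: eq_integral => x _; congr EFin.
  by rewrite fctE opprK addrC /stretched -powRrM mulNr (mulrC l).
- by move=> s _; rewrite stretched_pdf_ge0// ltW.
- by move=> s; exact: continuous_stretched_pdf.
Qed.

Lemma measurable_frechet_ccdf (c : R) :
  measurable_fun setT (fun x : R => (1 - expR (- (x `^ (- c))))%:E).
Proof.
apply/measurable_EFinP; apply: measurable_funB => //.
by apply: measurableT_comp => //; exact: measurableT_comp.
Qed.

Lemma frechet_ccdf_ge0 (c x : R) : (0 <= 1 - expR (- (x `^ (- c))))%R.
Proof. by rewrite subr_ge0 -[leRHS]expR0 ler_expR oppr_le0 powR_ge0. Qed.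

(** The tail is at most [1], which settles [x <= 1], and at most [x ^ (- c)]. *)
Lemma frechet_mean_lt_pinfty (c : R) : (1 < c)%R -> frechet_mean c < +oo.
Proof.
move=> c1.
have c0 : (0 < c)%R by exact: lt_trans c1.
have mf := measurable_frechet_ccdf c; have f0 := frechet_ccdf_ge0 c.
rewrite /frechet_mean (_ : `]0%R, +oo[%classic = `]0%R, 1%R] `|` `]1%R, +oo[); last first.
  apply/seteqP; split => x /=; rewrite !in_itv/= !andbT.
    by move=> ->; case: (leP x 1%R) => [|]; [left|right].
  by case=> [/andP[]|/(lt_trans ltr01)].
rewrite ge0_integral_setU//; last 3 first.
- exact: measurable_funTS.
- by move=> x _; rewrite lee_fin.
- apply/disj_setPS => x /= []; rewrite !in_itv/= andbT => /andP[_ x1].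
  by rewrite ltNge x1.
apply: (@le_lt_trans _ _ (\int[mu]_(x in `]0%R, 1%R]) 1 +
    \int[mu]_(x in `]1%R, +oo[) (x `^ (- c))%:E)).
  apply: leeD; apply: ge0_le_integral => //.
  - by move=> x _; rewrite lee_fin.
  - exact: measurable_funTS.
  - by move=> x _; rewrite lee_fin gerBl expR_ge0.
  - by move=> x _; rewrite lee_fin.
  - exact: measurable_funTS.
  - by apply/measurable_EFinP/measurable_funTS; exact: measurable_powR.
  - by move=> x _; rewrite lee_fin lerBlDl -lerBlDr; exact: expR_ge1Dx.
rewrite integral_cst// mul1e /= lebesgue_measure_itv/= lte_fin ltr01.
pose d := (c - 1)%R; have d0 : (0 < d)%R by rewrite subr_gt0.
have dF (x : R) : (0 < x)%R ->
    is_derive x 1%R (fun x => - d^-1 * x `^ (- d))%R (x `^ (- c))%R.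
  move=> x0; have := is_deriveZ (- d^-1)%R (is_derive1_powR (- d)%R x0).
  move/is_derive_eq; apply; rewrite /GRing.scale/= mulrA mulrNN mulVf ?gt_eqF//.
  by rewrite mul1r; congr powR; rewrite /d opprB addrAC subrr add0r.
rewrite integral_itv_obnd_cbnd; last first.
  by apply/measurable_EFinP/measurable_funTS; exact: measurable_powR.
rewrite (@ge0_continuous_FTC2y _ _ (fun x => - d^-1 * x `^ (- d))%R _ 0%R)//.
- exact: ltry.
- by move=> x _; exact: powR_ge0.
- apply: continuous_in_subspaceT => x; rewrite inE/= in_itv/= andbT => x1.
  exact/continuous_powR/(lt_le_trans ltr01).
- rewrite -[0%R](mulr0 (- d^-1)%R); apply: cvgM; first exact: cvg_cst.
  exact: cvg_powRNy.
- by move=> x x1; have [] := dF x (lt_trans ltr01 x1).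
- have [+ _] := dF 1%R ltr01.
  by move/derivable1_diffP/differentiable_continuous/cvg_at_right_filter.
- move=> x; rewrite in_itv/= andbT => x1.
  by rewrite derive1E; have [] := dF x (lt_trans ltr01 x1).
Qed.


End power_integrals.

Section gamma.
Local Open Scope ereal_scope.
Context {R : realType}.
Local Notation mu := (@lebesgue_measure R).

Lemma frechet_mean_gt0 (c : R) : (0 < c)%R -> 0 < frechet_mean c.
Proof.
move=> c0.
have mf := measurable_frechet_ccdf c; have f0 := frechet_ccdf_ge0 c.
apply: (@lt_le_trans _ _ (\int[mu]_(x in `]0%R, 1%R]) (1 - expR (- 1))%:E)).
  rewrite integral_cst//= lebesgue_measure_itv/= lte_fin ltr01 sube0 mule1.
  by rewrite lte_fin subr_gt0 -[ltRHS]expR0 ltr_expR oppr_lt0.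
apply: (@le_trans _ _ (\int[mu]_(x in `]0%R, 1%R]) (1 - expR (- (x `^ (- c))))%:E)).
  apply: ge0_le_integral => //.
  - exact: measurable_funTS.
  - move=> x; rewrite /= in_itv/= => /andP[x0 x1].
    rewrite lee_fin lerB// ler_expR lerN2 powRN invf_ge1 ?powR_gt0//.
    have := @ge0_ler_powR R c (ltW c0) x 1%R.
    by rewrite !nnegrE powR1; apply => //; exact: ltW.
apply: ge0_subset_integral => //.
- exact: measurable_funTS.
- by move=> x _; rewrite lee_fin.
- by apply: subset_itvl.
Qed.

(** [Gamma (1 - p)] is the moment of order [- p] of the exponential law. *)
Lemma Gamma_frechet_mean (p : R) : (0 < p < 1)%R ->
  (Gamma (1 - p))%:E = frechet_mean p^-1.
Proof.
move=> /andP[p0 p1].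
rewrite /Gamma /Rintegral.
rewrite (_ : \int[_]_(t in _) _ = frechet_mean p^-1); last first.
  rewrite -(mul1r p^-1%R) -(stretched_moment ltr01 p0).
  apply: eq_integral => s; rewrite inE/= in_itv/= andbT => s0; congr EFin.
  rewrite (_ : 1 - p - 1 = - p)%R; last by ring.
  by rewrite /stretched_pdf /stretched subrr powRr0 !mul1r powRr1 ?ltW// mulrC.
rewrite fineK// ge0_fin_numE.
  by apply: frechet_mean_lt_pinfty; rewrite invf_gt1.
by apply/ltW/frechet_mean_gt0; rewrite invr_gt0.
Qed.

Lemma Gamma_gt0 (p : R) : (0 < p < 1)%R -> (0 < Gamma (1 - p))%R.
Proof.
move=> p01; rewrite -lte_fin Gamma_frechet_mean//; apply: frechet_mean_gt0.
by rewrite invr_gt0; case/andP: p01.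
Qed.

End gamma.

(** * Densities depending on the sum of the coordinates *)

Section dirichlet.
Local Open Scope ereal_scope.
Context {R : realType}.
Local Notation mu := (@lebesgue_measure R).

(** The Beta integral of parameters [1 - p] and [1 - r].  It is extended-real
valued, being infinite when one of the parameters is at most [0]. *)
Definition dirichlet_mass (p r : R) : \bar R :=
  \int[mu]_(u in `]0%R, 1%R[) (u `^ (- p) * (1 - u) `^ (- r))%:E.

(** Pass to the coordinates [w = s + t] and [u = s / w]: translate the inner
integral by [s], exchange the integrals, and dilate the integral over
[0 < s < w] by the factor [w]. *)
Lemma dirichlet (p r : R) (phi : R -> R) : measurable_fun setT phi ->
  (forall w, (0 <= phi w)%R) ->
  \int[mu]_(s in `]0%R, +oo[) ((s `^ (- p))%:E *
    \int[mu]_(t in `]0%R, +oo[) (t `^ (- r) * phi (s + t))%:E) =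
  dirichlet_mass p r *
    \int[mu]_(w in `]0%R, +oo[) (phi w * w `^ (1 - p - r))%:E.
Proof.
move=> mphi phi0.
pose GR := measurableTypeR R.
pose S := [set z : GR * GR | (z.1 < z.2)%R].
have mS : measurable S.
  rewrite (_ : S = (fun z : GR * GR => (z.1 < z.2)%R) @^-1` [set true])//.
  rewrite -[X in measurable X]setTI.
  by apply: measurable_fun_ltr.
pose F (z : GR * GR) := (z.1 `^ (- p) * (\1_S z * ((z.2 - z.1) `^ (- r) * phi z.2)))%:E.
have SE s w : \1_S (s, w) = (s < w)%R%:R :> R.
  rewrite indicE /S; case: ltP => h; first by rewrite mem_set.
  by rewrite memNset//= => h'; rewrite ltNge h in h'.
have mF : measurable_fun setT F.
  apply/measurable_EFinP/measurable_funM.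
    by apply: (measurableT_comp (@measurable_powR R _)).
  apply: measurable_funM; first exact: measurable_indic.
  apply: measurable_funM; last exact: measurableT_comp.
  by apply: (measurableT_comp (@measurable_powR R _)); exact: measurable_funB.
have F0 z : 0 <= F z.
  by rewrite lee_fin !mulr_ge0 ?powR_ge0// indicE.
transitivity (\int[mu]_(s in `]0%R, +oo[) \int[mu]_(w in `]0%R, +oo[) F (s, w)).
  apply: eq_integral => s; rewrite inE/= in_itv/= andbT => s0.
  pose K (w : R) := ((w - s) `^ (- r) * phi w)%:E.
  have mK : measurable_fun setT K.
    apply/measurable_EFinP/measurable_funM => //.
    by apply: (measurableT_comp (@measurable_powR R _)); exact: measurable_funB.
  have K0 w : 0 <= K w by rewrite lee_fin mulr_ge0 ?powR_ge0.
  transitivity ((s `^ (- p))%:E * \int[mu]_(w in `]s, +oo[) K w).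
    congr (_ * _).
    transitivity (\int[mu]_(x in +%R s @^-1` `]s, +oo[) K (s + x)%R); last first.
      exact: integral_translate.
    rewrite (_ : _ @^-1` _ = `]0%R, +oo[%classic); last first.
      by apply/seteqP; split => x /=; rewrite !in_itv/= !andbT ltrDl.
    by apply: eq_integral => t _; rewrite /K (addrC s) addrK.
  rewrite -ge0_integralZl//; last 2 first.
  - exact: measurable_funTS.
  - by rewrite lee_fin powR_ge0.
  rewrite [LHS]integral_mkcond [RHS]integral_mkcond; apply: eq_integral => w _.
  rewrite !patchE !mem_setE !in_itv/= !andbT /F SE/=.
  case: (ltP s w) => sw; first by rewrite (lt_trans s0 sw) mul1r EFinM.
  by rewrite mul0r mulr0 if_same.
transitivity (\int[mu]_(w in `]0%R, +oo[) \int[mu]_(s in `]0%R, +oo[) F (s, w)).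
  by apply: (tonelli_in (T1 := GR) (T2 := GR) _ _ (f := F)).
rewrite muleC -ge0_integralZr//; last 3 first.
- apply/measurable_EFinP/measurable_funTS; exact: measurable_funM.
- by move=> w _; rewrite lee_fin mulr_ge0 ?powR_ge0.
- by apply: integral_ge0 => u _; rewrite lee_fin mulr_ge0 ?powR_ge0.
apply: eq_integral => w; rewrite inE/= in_itv/= andbT => w0.
(* The inner integral lives on ]0, w[, which a dilation maps from ]0, 1[. *)
pose K (s : R) := (s `^ (- p) * ((w - s) `^ (- r) * phi w))%:E.
have mK : measurable_fun setT K.
  apply/measurable_EFinP/measurable_funM; first exact: measurable_powR.
  apply: measurable_funM => //.
  by apply: (measurableT_comp (@measurable_powR R _)); exact: measurable_funB.
have K0 s : 0 <= K s by rewrite lee_fin !mulr_ge0 ?powR_ge0.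
transitivity (\int[mu]_(s in `]0%R, w[) K s).
  rewrite [LHS]integral_mkcond [RHS]integral_mkcond; apply: eq_integral => s _.
  rewrite !patchE !mem_setE !in_itv/= !andbT /F SE/=.
  case: (ltP s w) => sw; first by rewrite andbT mul1r.
  by rewrite andbF mul0r mulr0 if_same.
rewrite -(integral_dilate w0)//.
rewrite (_ : _ @^-1` _ = `]0%R, 1%R[%classic); last first.
  apply/seteqP; split => x /=; rewrite !in_itv/= pmulr_rgt0//.
    by rewrite gtr_pMr.
  by rewrite gtr_pMr.
pose c := (phi w * (w `^ (- p) * w `^ (- r)))%R.
have c0 : (0 <= c)%R by rewrite !mulr_ge0 ?powR_ge0.
transitivity (w%:E * \int[mu]_(u in `]0%R, 1%R[)
    (c%:E * (u `^ (- p) * (1 - u) `^ (- r))%:E)).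
  congr (_ * _); apply: eq_integral => u; rewrite inE/= in_itv/= => /andP[u0 u1].
  rewrite /K -EFinM; congr EFin.
  rewrite -[X in (X - w * u)%R]mulr1 -mulrBr.
  rewrite !powRM ?subr_ge0 ?(ltW u0) ?(ltW u1) ?(ltW w0)//.
  by rewrite /c; ring.
rewrite ge0_integralZl//; last 2 first.
- apply/measurable_EFinP/measurable_funTS/measurable_funM.
    exact: measurable_powR.
  by apply: (measurableT_comp (@measurable_powR R _)); exact: measurable_funB.
- by move=> u _; rewrite lee_fin mulr_ge0 ?powR_ge0.
rewrite muleA -EFinM; congr (_%:E * _).
rewrite /c -[X in (X * _)%R = _](powRr1 (ltW w0)) mulrCA; congr (_ * _)%R.
by rewrite mulrA -!powRD ?(gt_eqF w0) ?implybT.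
Qed.

End dirichlet.

Section simplex.
Local Open Scope ereal_scope.
Context {R : realType}.
Local Notation mu := (@lebesgue_measure R).

Lemma is_derive_translate (f : R -> R) (s t a : R) :
  is_derive (s + t)%R 1%R f a -> is_derive t 1%R (fun t => f (s + t))%R a.
Proof.
move=> fa; rewrite -[a]mulr1.
have h : is_derive t 1%R (+%R s) 1%R.
  by have := is_deriveD (is_derive_cst s t 1%R) (is_derive_id t 1%R); rewrite add0r.
exact: is_derive1_comp fa h.
Qed.

Lemma continuous_translate (f : R -> R) (s t : R) :
  {for (s + t)%R, continuous f} -> {for t, continuous (fun t => f (s + t)%R)}.
Proof.
move=> cf; have h : (s + x)%R @[x --> t] --> (s + t)%R.
  by apply: cvgD; [exact: cvg_cst|exact: cvg_id].
exact: (cvg_comp _ _ h cf).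
Qed.

Lemma measurable_translate (f : R -> R) (s : R) :
  measurable_fun setT f -> measurable_fun setT (fun t => f (s + t)%R).
Proof. by move=> mf; apply: measurableT_comp => //; exact: measurable_funD. Qed.

Lemma is_derive_stretched_pdfN (l s t : R) : (0 < s)%R -> (0 <= t)%R ->
  is_derive t 1%R (fun t => - stretched_pdf l (s + t))%R (stretched_pdfN1 l (s + t)).
Proof.
move=> s0 t0; rewrite -[stretched_pdfN1 _ _]opprK; apply: is_deriveN.
by apply: is_derive_translate; apply: is_derive_stretched_pdf; rewrite ltr_wpDr.
Qed.

(** The density of a pair with joint survival function [stretched l (s + t)]
has the marginal density [stretched_pdf l]. *)
Lemma integral_stretched_pdfN1 (l s : R) : (0 < l <= 1)%R -> (0 < s)%R ->
  \int[mu]_(t in `]0%R, +oo[) (stretched_pdfN1 l (s + t))%:E = (stretched_pdf l s)%:E.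
Proof.
move=> /andP[l0 l1] s0.
have ms : measurable_fun setT (fun t => stretched_pdfN1 l (s + t)%R).
  apply: (measurable_translate (f := stretched_pdfN1 l)).
  exact: measurable_stretched_pdfN1.
rewrite integral_itv_obnd_cbnd; last exact/measurable_EFinP/measurable_funTS.
have dF t := is_derive_stretched_pdfN l (t := t) s0.
rewrite (@ge0_continuous_FTC2y _ (fun t => stretched_pdfN1 l (s + t))
  (fun t => - stretched_pdf l (s + t))%R _ 0%R)//.
- by rewrite addr0 EFinN oppeK add0e.
- by move=> t _; rewrite stretched_pdfN1_ge0// (ltW l0) l1.
- apply: continuous_in_subspaceT => t; rewrite inE/= in_itv/= andbT => t0.
  apply: (continuous_translate (f := stretched_pdfN1 l)).
  apply: continuous_stretched_pdfN1.
  by rewrite ltr_wpDr.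
- rewrite -[0%R]oppr0; apply: cvgN.
  apply: (@cvg_comp _ _ _ (+%R s) (stretched_pdf l) _ +oo%R).
    apply/cvgryPge => A; near=> t; rewrite -lerBlDl; near: t.
    by apply: nbhs_pinfty_ge; rewrite num_real.
  by apply: cvg_stretched_pdf; rewrite l0.
- by move=> t t0; have [] := dF t (ltW t0).
- have [+ _] := dF 0%R (lexx _).
  by move/derivable1_diffP/differentiable_continuous/cvg_at_right_filter.
- move=> t; rewrite in_itv/= andbT => t0.
  by rewrite derive1E; have [] := dF t (ltW t0).
Unshelve. all: by end_near. Qed.

(** The moment of order [(- p, - r)] of the pair whose joint survival function
is [stretched l (s + t)]. *)
Definition simplex_moment (l p r : R) : \bar R :=
  \int[mu]_(s in `]0%R, +oo[) ((s `^ (- p))%:E *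
    \int[mu]_(t in `]0%R, +oo[) (t `^ (- r) * stretched_pdfN1 l (s + t))%:E).

(** By [dirichlet] each moment is a product of a factor depending on the
exponents only and a factor depending on the law and on the sum of the
exponents only; hence the cross-ratio is trivial.  It is stated as an equality of
products because the moments may be infinite. *)
Lemma simplex_moment_ratio (l m p r p' r' : R) :
  (0 <= l <= 1)%R -> (0 <= m <= 1)%R -> (p + r = p' + r')%R ->
  simplex_moment l p r * simplex_moment m p' r' =
  simplex_moment l p' r' * simplex_moment m p r.
Proof.
move=> l01 m01 pr.
have D k a b : (0 <= k <= 1)%R -> simplex_moment k a b = dirichlet_mass a b *
    \int[mu]_(w in `]0%R, +oo[) (stretched_pdfN1 k w * w `^ (1 - a - b))%:E.
  move=> k01; apply: dirichlet; first exact: measurable_stretched_pdfN1.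
  by move=> w; exact: stretched_pdfN1_ge0.
rewrite (D l p r l01) (D m p' r' m01) (D l p' r' l01) (D m p r m01).
rewrite -!addrA -!opprD pr.
move: (integral _ _ _) (integral _ _ _) => c e.
by rewrite muleACA [X in X * _]muleC muleACA.
Qed.

(** With a zero exponent the second coordinate integrates out. *)
Lemma simplex_moment_marginal (l p : R) : (0 < l <= 1)%R -> (0 < p)%R ->
  simplex_moment l p 0 = frechet_mean (l / p).
Proof.
move=> /[dup] l01 /andP[l0 l1] p0; rewrite -stretched_moment//.
apply: eq_integral => s; rewrite inE/= in_itv/= andbT => s0.
rewrite mulrC EFinM -integral_stretched_pdfN1//; congr (_ * _).
by apply: eq_integral => t _; rewrite oppr0 powRr0 mul1r.
Qed.

(** For [l = 1] the joint survival function factorizes: the coordinates are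
independent exponential variables. *)
Lemma simplex_moment_exponential (p r : R) : (0 < p)%R -> (0 < r)%R ->
  simplex_moment 1 p r = frechet_mean p^-1 * frechet_mean r^-1.
Proof.
move=> p0 r0; rewrite -[p^-1%R]mul1r -[r^-1%R]mul1r -!stretched_moment//.
have E s : (0 < s)%R -> stretched_pdf 1 s = expR (- s).
  by move=> s0; rewrite /stretched_pdf /stretched subrr powRr0 !mul1r powRr1// ltW.
rewrite -ge0_integralZr//; last 3 first.
- apply/measurable_EFinP/measurable_funTS/measurable_funM.
    exact: measurable_stretched_pdf.
  exact: measurable_powR.
- by move=> s _; rewrite lee_fin mulr_ge0 ?powR_ge0// stretched_pdf_ge0.
- by apply: integral_ge0 => s _; rewrite lee_fin mulr_ge0 ?powR_ge0// stretched_pdf_ge0.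
apply: eq_integral => s; rewrite inE/= in_itv/= andbT => s0.
rewrite mulrC EFinM -muleA; congr (_ * _).
rewrite -ge0_integralZl//; last 3 first.
- apply/measurable_EFinP/measurable_funTS/measurable_funM.
    exact: measurable_stretched_pdf.
  exact: measurable_powR.
- by move=> t _; rewrite lee_fin mulr_ge0 ?powR_ge0// stretched_pdf_ge0.
- by rewrite lee_fin stretched_pdf_ge0.
apply: eq_integral => t; rewrite inE/= in_itv/= andbT => t0.
rewrite -EFinM; congr EFin; rewrite /stretched_pdfN1.
rewrite subrr mul0r add0r mulr1 subrr powRr0 !mul1r /stretched.
rewrite powRr1 ?addr_ge0 ?ltW// opprD expRD !E//; ring.
Qed.

(** [power_moment] in [t], then, after exchanging the integrals, in [s].  The
integrand obtained is the probability, by inclusion-exclusion, that both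
coordinates are small, in other words that their negative powers exceed [x] and
[y]. *)
Lemma simplex_moment_joint_tail (l p r : R) : (0 < l <= 1)%R -> (0 < p)%R -> (0 < r)%R ->
  simplex_moment l p r =
  \int[mu]_(y in `]0%R, +oo[) \int[mu]_(x in `]0%R, +oo[)
    (1 - stretched l (x `^ (- p^-1)) - stretched l (y `^ (- r^-1))
       + stretched l (x `^ (- p^-1) + y `^ (- r^-1)))%:E.
Proof.
move=> /andP[l0 l1] p0 r0.
have l01 : (0 <= l <= 1)%R by rewrite (ltW l0).
pose b (y : R) := (y `^ (- r^-1))%R.
have b0 (y : R) : (0 < y)%R -> (0 < b y)%R by exact: powR_gt0.
have cW (s : R) : (0 < s)%R ->
    (- stretched_pdf l (s + t))%R @[t --> 0%R^'+] --> (- stretched_pdf l s)%R.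
  move=> s0; have [+ _] := is_derive_stretched_pdfN l s0 (lexx 0%R).
  move/derivable1_diffP/differentiable_continuous/cvg_at_right_filter.
  by rewrite addr0.
have c2 (s t : R) : (0 < s)%R -> (0 < t)%R ->
    {for t, continuous (fun t => stretched_pdfN1 l (s + t)%R)}.
  move=> s0 t0; apply: (continuous_translate (f := stretched_pdfN1 l)).
  by apply: continuous_stretched_pdfN1; rewrite addr_gt0.
have gN (s t : R) : (0 < s)%R -> (0 < t)%R ->
    (0 <= stretched_pdf l s - stretched_pdf l (s + t))%R.
  move=> s0 t0; rewrite -lee_fin.
  have <- : \int[mu]_(u in `]0%R, t[) (stretched_pdfN1 l (s + u))%:E =
      (stretched_pdf l s - stretched_pdf l (s + t))%:E.
    rewrite -[X in (X - _)%R]opprK addrC.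
    apply: (@integral_antiderivative R (fun t => stretched_pdfN1 l (s + t))
      (fun t => - stretched_pdf l (s + t))%R (- stretched_pdf l s)%R t t0).
    - by move=> u _; exact: stretched_pdfN1_ge0.
    - by move=> u; exact: c2.
    - by move=> u u0; apply: is_derive_stretched_pdfN => //; exact: ltW.
    - exact: cW.
  by apply: integral_ge0 => u _; rewrite lee_fin stretched_pdfN1_ge0.
(* What remains of the double moment once the inner integral is replaced by the
   increment of - stretched_pdf l between s and s + b y. *)
pose F (z : R * R) :=
  (z.1 `^ (- p) * (stretched_pdf l z.1 - stretched_pdf l (z.1 + b z.2)))%:E.
have mF : measurable_fun setT F.
  apply/measurable_EFinP/measurable_funM.
    by apply: (measurableT_comp (@measurable_powR R _)).
  apply: measurable_funB.
    by apply: (measurableT_comp (measurable_stretched_pdf l)).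
  apply: (measurableT_comp (measurable_stretched_pdf l)).
  apply: measurable_funD => //.
  by apply: (measurableT_comp (@measurable_powR R _)).
transitivity (\int[mu]_(s in `]0%R, +oo[) \int[mu]_(y in `]0%R, +oo[) F (s, y)).
  apply: eq_integral => s; rewrite inE/= in_itv/= andbT => s0.
  transitivity ((s `^ (- p))%:E * \int[mu]_(y in `]0%R, +oo[)
      (- stretched_pdf l (s + y `^ (- r^-1)) - (- stretched_pdf l s))%:E).
    congr (_ * _).
    under eq_integral do rewrite mulrC.
    apply: (@power_moment R (fun t => stretched_pdfN1 l (s + t))
      (fun t => - stretched_pdf l (s + t))%R (- stretched_pdf l s)%R r r0).
    - apply: (measurable_translate (f := stretched_pdfN1 l)).
      exact: measurable_stretched_pdfN1.
    - by move=> t _; exact: stretched_pdfN1_ge0.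
    - by move=> t; exact: c2.
    - by move=> t t0; apply: is_derive_stretched_pdfN => //; exact: ltW.
    - exact: cW.
  rewrite -ge0_integralZl//.
  - apply: eq_integral => y _; rewrite -EFinM; congr EFin.
    by rewrite /= opprK addrC.
  - apply/measurable_EFinP/measurable_funTS/measurable_funB => //.
    apply: measurableT_comp => //.
    apply: (measurableT_comp (measurable_stretched_pdf l)).
    by apply: measurable_funD => //; exact: measurable_powR.
  - move=> y; rewrite /= in_itv/= andbT => y0.
    by rewrite lee_fin opprK addrC gN ?b0.
  - by rewrite lee_fin powR_ge0.
transitivity (\int[mu]_(y in `]0%R, +oo[) \int[mu]_(s in `]0%R, +oo[) F (s, y)).
  apply: (tonelli_in (T1 := measurableTypeR R) (T2 := measurableTypeR R)) => //.
  move=> s y; rewrite /= !in_itv/= !andbT => s0 y0.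
  by rewrite lee_fin mulr_ge0 ?powR_ge0// gN ?b0.
apply: eq_integral => y; rewrite inE/= in_itv/= andbT => y0.
have by0 := b0 _ y0.
rewrite (_ : (fun s => F (s, y)) = (fun s =>
    ((stretched_pdf l s - stretched_pdf l (b y + s)) * s `^ (- p))%:E)); last first.
  by apply/funext => s; rewrite /F/= mulrC (addrC s).
transitivity (\int[mu]_(x in `]0%R, +oo[)
    ((- stretched l (x `^ (- p^-1)) + stretched l (b y + x `^ (- p^-1)))
     - (- 1 + stretched l (b y)))%:E); last first.
  apply: eq_integral => x _; congr EFin; rewrite (addrC (b y)) -/(b y).
  by move: (stretched _ _) (stretched _ _) (stretched _ _) => A B C; ring.
apply: (@power_moment R _ (fun s => - stretched l s + stretched l (b y + s))%R
  (- 1 + stretched l (b y))%R p p0).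
- apply: measurable_funB; first exact: measurable_stretched_pdf.
  apply: (measurable_translate (f := stretched_pdf l)).
  exact: measurable_stretched_pdf.
- by move=> s s0; rewrite (addrC (b y)) gN.
- move=> s s0; apply: cvgB; first exact: continuous_stretched_pdf.
  apply: (continuous_translate (f := stretched_pdf l)).
  by apply: continuous_stretched_pdf; rewrite addr_gt0.
- move=> s s0; rewrite -[X in (X - _)%R]opprK; apply: is_deriveD.
    by apply: is_deriveN; exact: is_derive_stretched.
  by apply: is_derive_translate; apply: is_derive_stretched; rewrite addr_gt0.
- apply: cvgD; first by apply: cvgN; exact: cvg_stretched.
  have [+ _] : is_derive (0%R : R) 1%R (fun s : R => stretched l (b y + s))%R
      (- stretched_pdf l (b y + 0))%R.
    by apply: is_derive_translate; apply: is_derive_stretched; rewrite addr0.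
  move/derivable1_diffP/differentiable_continuous/cvg_at_right_filter.
  by rewrite addr0.
Qed.

End simplex.

(** * Expectations as integrals of tail probabilities *)

Section tails.
Local Open Scope ereal_scope.
Context d (T : measurableType d) (R : realType) (P : probability T R).
Local Notation mu := (@lebesgue_measure R).

Lemma measurable_preimage_Ny (X : {RV P >-> R}) (x : R) :
  measurable (X @^-1` `]-oo, x]).
Proof. exact: measurable_funPTI. Qed.

Lemma funrpos_gtE (X : T -> R) (x : R) : (0 <= x)%R ->
  [set t | (x < X^\+%R t)%R] = ~` (X @^-1` `]-oo, x]).
Proof.
move=> x0; apply/seteqP; split => t /=; rewrite in_itv/= /funrpos lt_max.
  by case/orP => [|/lt_le_trans/(_ x0)]; rewrite ?ltxx// ltNge => /negP.
by move/negP; rewrite -ltNge => ->.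
Qed.

(** The layer-cake formula for the factor [Y], with weight [X], and then for
[X].  Positive parts make it applicable to variables that are nonnegative only
almost surely. *)
Lemma expectation_product_tail (X Y : {RV P >-> R}) :
  \int[P]_t (X^\+%R t * Y^\+%R t)%:E =
  \int[mu]_(y in `]0%R, +oo[) \int[mu]_(x in `]0%R, +oo[)
    P (~` (X @^-1` `]-oo, x] `|` Y @^-1` `]-oo, y])).
Proof.
have mX : measurable_fun setT (X^\+)%R by exact: measurable_funrpos.
have mY : measurable_fun setT (Y^\+)%R by exact: measurable_funrpos.
transitivity (\int[P]_t ((X^\+%R t)%:E * (Y^\+%R t)%:E)) => //.
rewrite layer_cake//; last 2 first.
- exact/measurable_EFinP.
- by move=> t; rewrite lee_fin funrpos_ge0.
apply: eq_integral => y; rewrite inE/= in_itv/= andbT => /ltW y0.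
have mD : measurable (~` (Y @^-1` `]-oo, y])).
  by apply: measurableC; exact: measurable_preimage_Ny.
rewrite setTI funrpos_gtE//.
transitivity (\int[P]_(t in ~` (Y @^-1` `]-oo, y])) (cst 1 t * (X^\+%R t)%:E)).
  by apply: eq_integral => t _; rewrite /= mul1e.
rewrite layer_cake//.
apply: eq_integral => x; rewrite inE/= in_itv/= andbT => /ltW x0.
rewrite funrpos_gtE// integral_cst ?mul1e; last first.
  by apply: measurableI => //; apply: measurableC; exact: measurable_preimage_Ny.
by rewrite setIC -setCU.
Qed.

Lemma probability_both_exceed (X Y : {RV P >-> R}) (x y u v w : R) :
  cdf X x = u%:E -> cdf Y y = v%:E -> joint_cdf X Y x y = w%:E ->
  P (~` (X @^-1` `]-oo, x] `|` Y @^-1` `]-oo, y])) = (1 - u - v + w)%:E.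
Proof.
move=> Xu Yv XYw.
have {}Xu : P (X @^-1` `]-oo, x]) = u%:E by exact: Xu.
have {}Yv : P (Y @^-1` `]-oo, y]) = v%:E by exact: Yv.
have {}XYw : P (X @^-1` `]-oo, x] `&` Y @^-1` `]-oo, y]) = w%:E by exact: XYw.
have mX := measurable_preimage_Ny X x; have mY := measurable_preimage_Ny Y y.
rewrite probability_setC; last exact: measurableU.
have -> : P (X @^-1` `]-oo, x] `|` Y @^-1` `]-oo, y]) =
    P (X @^-1` `]-oo, x]) + P (Y @^-1` `]-oo, y])
    - P (X @^-1` `]-oo, x] `&` Y @^-1` `]-oo, y]).
  apply: measureUfinl => //; apply: (@le_lt_trans _ _ u%:E); last exact: ltry.
  by rewrite -Xu.
rewrite Xu Yv XYw -[LHS]/((1 - (u + v - w))%:E); congr EFin; ring.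
Qed.

Lemma expectation_powR_tail (X : {RV P >-> R}) (k : R) : (0 < k)%R ->
  \int[P]_t ((X^\+%R t) `^ k)%:E =
  \int[mu]_(x in `]0%R, +oo[) P (~` (X @^-1` `]-oo, (x `^ k^-1)%R])).
Proof.
move=> k0.
have mX : measurable_fun setT (X^\+)%R by exact: measurable_funrpos.
transitivity (\int[P]_t (cst 1 t * ((X^\+%R t) `^ k)%:E)).
  by apply: eq_integral => t _; rewrite /= mul1e.
rewrite layer_cake//; last 2 first.
- by apply: (measurableT_comp (@measurable_powR R _)).
- by move=> t; rewrite powR_ge0.
apply: eq_integral => x; rewrite inE/= in_itv/= andbT => x0.
rewrite setTI integral_cst ?mul1e.
  rewrite -funrpos_gtE ?powR_ge0//; congr (P _).
  have k1 : (0 < k^-1)%R by rewrite invr_gt0.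
  have E (a b : R) : (0 < a)%R -> (0 <= b)%R -> (a < b `^ k)%R = (a `^ k^-1 < b)%R.
    move=> a0 b0; apply/idP/idP => ab.
      have := gt0_ltr_powR k1 _ _ ab; rewrite -powRrM mulfV ?gt_eqF// powRr1//.
      by apply; rewrite nnegrE ?powR_ge0// ltW.
    have := gt0_ltr_powR k0 _ _ ab; rewrite -powRrM mulVf ?gt_eqF// powRr1 ?ltW//.
    by apply; rewrite nnegrE ?powR_ge0.
  by apply/seteqP; split => t /=; rewrite E// funrpos_ge0.
rewrite [X in measurable X](_ : _ = (fun t => (x < X^\+%R t `^ k)%R) @^-1` [set true])//.
rewrite -[X in measurable X]setTI; apply: measurable_fun_ltr => //.
by apply: (measurableT_comp (@measurable_powR R _)).
Qed.

Lemma Lfun1_ae_eq (Z Z' : T -> R) (r : R) :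
  measurable_fun setT Z -> measurable_fun setT Z' -> (forall t, (0 <= Z' t)%R) ->
  ae_eq P setT Z Z' -> \int[P]_t (Z' t)%:E = r%:E ->
  Z \in Lfun P 1 /\ 'E_P[Z] = r%:E.
Proof.
move=> mZ mZ' Z'0 ZZ' Z'r.
have ZZ'E : ae_eq P setT (EFin \o Z) (EFin \o Z') by exact: ae_eq_comp.
split; last by rewrite unlock -Z'r; apply: ae_eq_integral => //; exact/measurable_EFinP.
apply/Lfun1_integrable/integrableP; split; first exact/measurable_EFinP.
rewrite (_ : \int[P]_x _ = r%:E) ?ltry// -Z'r.
apply: ge0_ae_eq_integral => //.
- by apply: measurableT_comp => //; exact/measurable_EFinP.
- exact/measurable_EFinP.
- by move=> t _; rewrite lee_fin.
- have := ae_eq_abse ZZ'E; rewrite (_ : abse \o (EFin \o Z') = EFin \o Z')//.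
  by apply/funext => t /=; rewrite ger0_norm.
Qed.

End tails.

(** * Moments of the Fréchet distribution *)

Section frechet.
Local Open Scope ereal_scope.
Context d (T : measurableType d) (R : realType) (P : probability T R).
Context (alpha : R) (X : {RV P >-> R})
  (frechet_X : has_frechet_distribution alpha X).

Lemma frechet_cdfE (x : R) : (0 < x)%R ->
  cdf X x = (expR (- (x `^ (- alpha))))%:E.
Proof. by move=> x0; rewrite frechet_X /frechet_cdf x0. Qed.

Lemma frechet_ae_nneg : ae_eq P setT X (X^\+)%R.
Proof.
have X0 : P (X @^-1` `]-oo, 0%R]) = 0.
  by have := frechet_X 0%R; rewrite /frechet_cdf ltxx.
apply: (@negligibleS _ _ _ _ (X @^-1` `]-oo, 0%R])); last first.
  by apply/negligibleP => //; exact: measurable_preimage_Ny.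
move=> t /= nXt; rewrite in_itv/= leNgt; apply/negP => Xt; apply: nXt => _.
by rewrite /funrpos; apply/esym/max_idPl/ltW.
Qed.

(** The [k]-th power of a Fréchet variable of shape [alpha] is a Fréchet variable
of shape [alpha / k]. *)
Lemma frechet_powR_moment (k : R) : (0 < k)%R ->
  \int[P]_t ((X^\+%R t) `^ k)%:E = frechet_mean (alpha / k).
Proof.
move=> k0; rewrite expectation_powR_tail//.
apply: eq_integral => x; rewrite inE/= in_itv/= andbT => x0.
rewrite probability_setC; last exact: measurable_preimage_Ny.
have -> : P (X @^-1` `]-oo, (x `^ k^-1)%R]) = (expR (- (x `^ (- (alpha / k)))))%:E.
  rewrite [LHS](frechet_cdfE (powR_gt0 _ x0)) -powRrM.
  by rewrite mulrN mulrC.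
by [].
Qed.

Lemma frechet_moment (k : nat) : (0 < k)%N -> (k%:R < alpha)%R ->
  (fun t => X t ^+ k)%R \in Lfun P 1 /\
  'E_P[(fun t => X t ^+ k)%R] = (Gamma (1 - k%:R / alpha))%:E.
Proof.
move=> k0 ka; have k0' : (0 < k%:R :> R)%R by rewrite ltr0n.
have a0 : (0 < alpha)%R by exact: lt_trans ka.
have mX : measurable_fun setT (X^\+)%R by exact: measurable_funrpos.
apply: (@Lfun1_ae_eq _ _ _ _ _ (fun t => X^\+ t ^+ k)%R).
- exact: measurable_funX.
- exact: measurable_funX.
- by move=> t; rewrite exprn_ge0// funrpos_ge0.
- exact: (ae_eq_comp (fun x : R => x ^+ k)%R frechet_ae_nneg).
- under eq_integral do rewrite -powR_mulrn ?funrpos_ge0//.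
  rewrite frechet_powR_moment// Gamma_frechet_mean ?invf_div//.
  by rewrite divr_gt0//= ltr_pdivrMr// mul1r.
Qed.

Lemma frechet_Lfun : (1 < alpha)%R -> (X : T -> R) \in Lfun P 1.
Proof. by move=> a1; have [] := frechet_moment (k := 1) isT a1. Qed.

Lemma frechet_expectation : (1 < alpha)%R -> 'E_P[X] = (Gamma (1 - 1 / alpha))%:E.
Proof. by move=> a1; have [_ <-] := frechet_moment (k := 1) isT a1. Qed.

Lemma frechet_variance : (2 < alpha)%R ->
  'V_P[X] = (Gamma (1 - 2 / alpha) - Gamma (1 - 1 / alpha) ^+ 2)%:E.
Proof.
move=> a2; have a1 : (1 < alpha)%R by apply: lt_trans a2; rewrite ltr1n.
have [L2 E2] := frechet_moment (k := 2) isT a2.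
rewrite /variance covarianceE ?frechet_Lfun//.
by rewrite [X in X - _]E2 frechet_expectation.
Qed.

(** With a zero variance, Chebyshev's inequality would make the event
[X <= m / 2] negligible, [m] being the mean, while the distribution function of
[X] is positive at [m / 2]. *)
Lemma frechet_variance_gt0 : (2 < alpha)%R ->
  (0 < Gamma (1 - 2 / alpha) - Gamma (1 - 1 / alpha) ^+ 2)%R.
Proof.
move=> a2; have a1 : (1 < alpha)%R by apply: lt_trans a2; rewrite ltr1n.
have a0 : (0 < alpha)%R by exact: lt_trans a1.
set m := Gamma (1 - 1 / alpha).
have m0 : (0 < m)%R by apply: Gamma_gt0; rewrite div1r invr_gt0 a0 invf_lt1.
rewrite ltNge; apply/negP => v0.
have m20 : (0 < m / 2)%R by rewrite divr_gt0.
have := chebyshev X m20; rewrite frechet_variance// frechet_expectation//= -/m.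
apply/negP; rewrite -ltNge; apply: (@le_lt_trans _ _ 0).
  by rewrite -EFinM lee_fin mulr_ge0_le0// invr_ge0 exprn_ge0// ltW.
apply: (@lt_le_trans _ _ (cdf X (m / 2))).
  by rewrite frechet_cdfE// lte_fin expR_gt0.
rewrite -[cdf X _]/(P (X @^-1` `]-oo, (m / 2)%R])).
apply: le_measure; rewrite ?inE.
- exact: measurable_preimage_Ny.
- rewrite [X in measurable X](_ : _ =
    (fun t => (m / 2 <= `|X t - m|)%R) @^-1` [set true])//.
  rewrite -[X in measurable X]setTI; apply: measurable_fun_ler => //.
  by apply: measurableT_comp => //; exact: measurable_funB.
- move=> t /=; rewrite in_itv/= => Xt.
  by rewrite distrC; apply: le_trans (ler_norm _); lra.
Qed.

End frechet.

(** * The mixed moment under the Gumbel copula *)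

Section gumbel.
Local Open Scope ereal_scope.
Context d (T : measurableType d) (R : realType) (P : probability T R).

(** Both [X ^ (- 1 / q)] and [Y ^ (- 1 / q)], with [q = l / alpha], have survival
function [stretched l], and the copula couples them into a pair with joint
survival function [stretched l (s + t)]. *)
Lemma gumbel_frechet_expectationM (alpha l : R) (X Y : {RV P >-> R}) :
  (2 < alpha)%R -> (0 < l < 1)%R ->
  has_frechet_distribution alpha X -> has_frechet_distribution alpha Y ->
  coupled_by (gumbel_copula (1 / l)) (frechet_cdf alpha) (frechet_cdf alpha) X Y ->
  ((X : T -> R) * (Y : T -> R))%R \in Lfun P 1 /\
  'E_P[(X : T -> R) * (Y : T -> R)] = (Gamma (1 - 2 / alpha) * Gamma (1 - l / alpha) ^+ 2
    / Gamma (1 - 2 * l / alpha))%:E.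
Proof.
move=> a2 /andP[l0 l1] fX fY cXY.
have a0 : (0 < alpha)%R by exact: lt_trans a2.
pose q := (l / alpha)%R.
have q0 : (0 < q)%R by rewrite divr_gt0.
have q21 : (2 * q < 1)%R.
  by rewrite /q mulrA ltr_pdivrMr// mul1r; nra.
have q1 : (q < 1)%R by lra.
have aq : (- q^-1 * l = - alpha)%R.
  by rewrite /q invf_div mulNr divfK ?gt_eqF.
have qla x : (x `^ (- q^-1) = (x `^ (- alpha)) `^ (1 / l))%R.
  by rewrite -powRrM -aq -mulrA div1r mulfV ?gt_eqF// mulr1.
(* The level x of X corresponds to the level x ^ (- 1 / q) of the coordinate. *)
have tailq : simplex_moment l q q = \int[P]_t (X^\+%R t * Y^\+%R t)%:E.
  rewrite expectation_product_tail simplex_moment_joint_tail ?l0 ?ltW//.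
  apply: eq_integral => y; rewrite inE/= in_itv/= andbT => y0.
  apply: eq_integral => x; rewrite inE/= in_itv/= andbT => x0.
  rewrite (probability_both_exceed (frechet_cdfE fX x0) (frechet_cdfE fY y0) (cXY x y)).
  congr EFin; rewrite /gumbel_copula /frechet_cdf x0 y0 !leNgt !expR_gt0/=.
  rewrite !expRK !opprK -!qla div1r invrK /stretched -!powRrM aq.
  by [].
have E1 : simplex_moment 1 (2 * q) 0 = (Gamma (1 - 2 * l / alpha))%:E.
  have p0 : (0 < 2 * q)%R by rewrite mulr_gt0.
  rewrite -(mulrA 2%R) -/q (Gamma_frechet_mean (p := 2 * q)) ?p0//.
  have h1 : (0 < 1 :> R)%R && (1 <= 1 :> R)%R by rewrite ltr01 lexx.
  by rewrite (simplex_moment_marginal h1 p0) div1r.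
have E2 : simplex_moment l (2 * q) 0 = (Gamma (1 - 2 / alpha))%:E.
  have p0 : (0 < 2 * q)%R by rewrite mulr_gt0.
  have p1 : (0 < 2 / alpha < 1)%R by rewrite divr_gt0//= ltr_pdivrMr// mul1r.
  have hl : (0 < l <= 1)%R by rewrite l0 ltW.
  have ql : (l / (2 * q) = (2 / alpha)^-1)%R by rewrite /q; field; rewrite !gt_eqF.
  by rewrite (Gamma_frechet_mean p1) (simplex_moment_marginal hl p0) ql.
have E3 : simplex_moment 1 q q = (Gamma (1 - l / alpha) ^+ 2)%:E.
  have p1 : (0 < q < 1)%R by rewrite q0.
  by rewrite expr2 EFinM -/q (Gamma_frechet_mean p1) (simplex_moment_exponential q0 q0).
have main : simplex_moment l q q * (Gamma (1 - 2 * l / alpha))%:E =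
    (Gamma (1 - 2 / alpha) * Gamma (1 - l / alpha) ^+ 2)%:E.
  rewrite EFinM -E1 -E2 -E3; apply: simplex_moment_ratio.
  - by rewrite (ltW l0) ltW.
  - by rewrite ler01 lexx.
  - by rewrite addr0 mulr_natl mulr2n.
have G0 : (0 < Gamma (1 - 2 * l / alpha))%R.
  by rewrite -mulrA; apply: Gamma_gt0; rewrite mulr_gt0.
have mX : measurable_fun setT (X^\+)%R by exact: measurable_funrpos.
have mY : measurable_fun setT (Y^\+)%R by exact: measurable_funrpos.
apply: (@Lfun1_ae_eq _ _ _ _ _ (fun t => X^\+ t * Y^\+ t)%R).
- exact: measurable_funM.
- exact: measurable_funM.
- by move=> t; rewrite mulr_ge0// funrpos_ge0.
- move: (frechet_ae_nneg fX) (frechet_ae_nneg fY); apply: filterS2.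
  by move=> t Xt Yt _; rewrite /= -Xt// -Yt.
- by rewrite -tailq EFinM -main -muleA -EFinM mulfV ?gt_eqF// mule1.
Qed.

End gumbel.

Theorem proposition3 (d : measure_display) (T : measurableType d)
    (R : realType) (P : probability T R) (alpha lambda : R)
    (delta1 delta2 : {RV P >-> R})
    (halpha : 2 < alpha) (hlambda0 : 0 < lambda) (hlambda1 : lambda < 1)
    (hdelta1 : has_frechet_distribution alpha delta1)
    (hdelta2 : has_frechet_distribution alpha delta2)
    (hcoupled : coupled_by (gumbel_copula (1 / lambda))
                  (frechet_cdf alpha) (frechet_cdf alpha) delta1 delta2) :
  correlation P delta1 delta2 =
    ((Gamma (1 - 2 / alpha) * Gamma (1 - lambda / alpha) ^+ 2
        / Gamma (1 - 2 * lambda / alpha)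
      - Gamma (1 - 1 / alpha) ^+ 2)
     / (Gamma (1 - 2 / alpha) - Gamma (1 - 1 / alpha) ^+ 2))%:E.
Proof.
have a1 : 1 < alpha by apply: lt_trans halpha; rewrite ltr1n.
have l01 : 0 < lambda < 1 by rewrite hlambda0.
have [L12 E12] := gumbel_frechet_expectationM halpha l01 hdelta1 hdelta2 hcoupled.
have v0 := frechet_variance_gt0 hdelta1 halpha.
rewrite /correlation (frechet_variance hdelta1 halpha) (frechet_variance hdelta2 halpha).
rewrite covarianceE ?(frechet_Lfun hdelta1 a1) ?(frechet_Lfun hdelta2 a1)//.
rewrite [X in (X - _)%E]E12 (frechet_expectation hdelta1 a1) (frechet_expectation hdelta2 a1).
move: v0; set v := (X in 0 < X) => v0.
have -> : (sqrte v%:E * sqrte v%:E = v%:E)%E.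
  by rewrite /= -EFinM -expr2 sqr_sqrtr// ltW.
by rewrite inver gt_eqF// [in RHS]expr2.
Qed.
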